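(* Let $A\in\mathbb{R}^{m\times m}$ be an intensity matrix. Then the final limit $P:=\lim_{t\to\infty}\exp(tA)$ exists, and it equals the projector onto $N(A)$ along $R(A)$; that is, $\mathbb{C}^m=N(A)\oplus R(A)$ and the map $x\mapsto xP$ on row vectors $x\in\mathbb{C}^m$ is the projector onto $N(A)$ along $R(A)$.
   Context: A row intensity matrix is a real square matrix $(a_{ij})$ with $a_{ij}\ge0$ for all $i\neq j$ and all row sums equal to zero; a column intensity matrix is defined analogously with all column sums equal to zero. An intensity matrix is a row intensity matrix or a column intensity matrix. For a matrix $A\in\mathbb{C}^{m\times m}$, with elements of $\mathbb{C}^m$ regarded as row vectors, $N(A):=\{x\in\mathbb{C}^m\mid xA=0\}$ is the left nullspace and $R(A):=\{xA\mid x\in\mathbb{C}^m\}$ is the left image space. *)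

(* Defs.v *)
From HB Require Import structures.
From mathcomp Require Import all_boot all_order all_algebra.
From mathcomp Require Import all_classical all_reals all_analysis.
From mathcomp Require Import complex.

Set Implicit Arguments.
Unset Strict Implicit.
Unset Printing Implicit Defensive.

Import Order.TTheory GRing.Theory Num.Theory.
Import numFieldNormedType.Exports.

Local Open Scope classical_set_scope.
Local Open Scope ring_scope.

Definition row_intensity (R : realType) (m : nat) (A : 'M[R]_m) : Prop :=
  (forall i j, i != j -> 0 <= A i j) /\ (forall i, \sum_j A i j = 0).

Definition column_intensity (R : realType) (m : nat) (A : 'M[R]_m) : Prop :=
  (forall i j, i != j -> 0 <= A i j) /\ (forall j, \sum_i A i j = 0).

Definition intensity (R : realType) (m : nat) (A : 'M[R]_m) : Prop :=
  row_intensity A \/ column_intensity A.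

(* The limit is taken in the normed space of m x m matrices. *)
Definition expmx (R : realType) (m : nat) (A : 'M[R]_m) : 'M[R]_m :=
  lim ([series (k`!%:R)^-1 *: A ^+ k]_k @ \oo).

Definition complexmx (R : realType) (m n : nat) (A : 'M[R]_(m, n)) :
  'M[R[i]]_(m, n) := map_mx (real_complex R) A.

(* Vectors are rows acted on from the right: the left nullspace of A is the
   row space of kermx A, and its left image is the row space of A itself. *)
Definition left_null (F : fieldType) (m : nat) (A : 'M[F]_m) : 'M[F]_m :=
  kermx A.

Definition left_image (F : fieldType) (m : nat) (A : 'M[F]_m) : 'M[F]_m := A.

Lemma left_nullP (F : fieldType) (m : nat) (A : 'M[F]_m) (x : 'rV[F]_m) :
  reflect (x *m A = 0) (x <= left_null A)%MS.
Proof. exact: sub_kermxP. Qed.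

Lemma left_imageP (F : fieldType) (m : nat) (A : 'M[F]_m) (x : 'rV[F]_m) :
  reflect (exists y : 'rV[F]_m, x = y *m A) (x <= left_image A)%MS.
Proof. exact: submxP. Qed.

(* Main.v *)
Require Import Defs.
From HB Require Import structures.
From mathcomp Require Import all_boot all_order all_algebra.
From mathcomp Require Import all_classical all_reals all_analysis.
From mathcomp Require Import complex.
From mathcomp Require Import ring lra.

Set Implicit Arguments.
Unset Strict Implicit.
Unset Printing Implicit Defensive.

Import Order.TTheory GRing.Theory Num.Theory.
Import numFieldNormedType.Exports.

Local Open Scope classical_set_scope.
Local Open Scope ring_scope.

(** The heart of the matter is that A exp(tA) tends to 0 as t grows
    (mul_expmx_cvg0); everything else is linear algebra.

    Linear algebra.  Write 1 = U K + V A, where the rows of K = kermx A span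
    N(A).  As K A = 0, K exp(tA) = K, so that exp(tA) = U K + V A exp(tA) tends
    to P = U K; passing to the limit gives A P = 0 and K P = K, which
    characterizes the projector onto N(A) along R(A).  The decomposition of 1
    exists as soon as N(A) and R(A) meet trivially, by the rank theorem; and if
    x = y A with x A = 0, then x = x exp(tA) = y A exp(tA) for all t, hence
    x = 0.  All this takes place over the real numbers, and carries over to the
    complex ones because kernels, intersections and ranks of matrices commute
    with the extension of scalars.

    Decay of A exp(tA).  Choose c with A + c >= 0 entrywise, put M = tA, x = ct
    and W = M + x.  The rows (or the columns) of W sum to x, so the entries of
    W ^ k lie between 0 and x ^ k.  As exp(W) = e^x exp(M), the matrix
    M exp(M) is e^(-x) (W - x) exp(W), that is,
    e^(-x) sum_k (k - x) W^k / k!, whose entries are bounded in absolute value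
    by the mean absolute deviation of a Poisson variable of parameter x, hence
    by the square root of its variance x.  Dividing by t, A exp(tA) = O(t^(-1/2)). *)

(** * Limits of matrices *)

Lemma cvg_entrywise (R : realType) (m n : nat) (T : Type)
    (F : set_system T) {FF : Filter F} (f : T -> 'M[R]_(m, n)) (L : 'M[R]_(m, n)) :
  (forall i j, f t i j @[t --> F] --> L i j) -> f t @[t --> F] --> L.
Proof.
move=> fL U [P nbhsP PU].
have : \forall t \near F, forall i j, P i j (f t i j).
  by apply: filter_forall => i; apply: filter_forall => j; exact/fL/nbhsP.
by apply: filterS => t; exact: PU.
Qed.

Lemma entry_cvg (R : realType) (m n : nat) (T : Type)
    (F : set_system T) {FF : Filter F} (f : T -> 'M[R]_(m, n)) (L : 'M[R]_(m, n)) i j :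
  f t @[t --> F] --> L -> f t i j @[t --> F] --> L i j.
Proof. by move=> fL; exact: (cvg_comp _ _ fL (@coord_continuous _ _ _ i j L)). Qed.

Lemma cvg_mulmxl (R : realType) (m n p : nat) (C : 'M[R]_(m, n)) (T : Type)
    (F : set_system T) {FF : Filter F} (f : T -> 'M[R]_(n, p)) (L : 'M[R]_(n, p)) :
  f t @[t --> F] --> L -> C *m f t @[t --> F] --> C *m L.
Proof.
move=> fL; apply: cvg_entrywise => i j; rewrite !mxE.
under eq_fun do rewrite mxE.
apply: cvg_big => [|k _]; first exact: add_continuous.
by apply: cvgMl_tmp; exact: entry_cvg.
Qed.

(** * The exponential series of a matrix *)

Lemma norm_exprmx_le (R : realType) (m : nat) (A : 'M[R]_m) :
  exists2 a : R, 0 <= a & forall k i j, `|(A ^+ k) i j| <= a ^+ k.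
Proof.
exists (\sum_i \sum_j `|A i j|); first by do 2!apply: sumr_ge0 => ? _.
set a := \sum_i _.
elim=> [|k IH] i j.
  by rewrite !expr0 mxE; case: eqP => _; rewrite ?normr1// normr0.
rewrite !exprS mxE (le_trans (ler_norm_sum _ _ _))//.
rewrite (@le_trans _ _ (\sum_l `|A i l| * a ^+ k))//.
  by apply: ler_sum => l _; rewrite normrM ler_wpM2l.
rewrite -mulr_suml ler_wpM2r//.
  by apply/exprn_ge0; do 2!apply: sumr_ge0 => ? _.
rewrite /a [leRHS](bigD1 i)//= lerDl; apply: sumr_ge0 => l _; exact: sumr_ge0.
Qed.

Definition expmx_entry_coeff (R : realType) (m : nat) (A : 'M[R]_m) i j (k : nat) : R :=
  (k`!%:R)^-1 * (A ^+ k) i j.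

(** Comparison with the exponential series of a scalar: it gives the
    convergence of the matrix series here, and controls the Cauchy product
    below. *)
Lemma expmx_entry_dominated (R : realType) (m : nat) (A : 'M[R]_m) (a : R) k i j :
  (forall k i j, `|(A ^+ k) i j| <= a ^+ k) ->
  `|expmx_entry_coeff A i j k| <= exp_coeff a k.
Proof.
move=> Aa; rewrite /exp_coeff /expmx_entry_coeff/= normrM mulrC.
by rewrite [X in _ * X]ger0_norm// ler_wpM2r.
Qed.

Lemma series_expmxE (R : realType) (m : nat) (A : 'M[R]_m) n i j :
  [series (k`!%:R)^-1 *: A ^+ k]_k n i j = series (expmx_entry_coeff A i j) n.
Proof. by rewrite /series/= summxE; apply: eq_bigr => k _; rewrite mxE. Qed.

Lemma expmx_cvg (R : realType) (m : nat) (A : 'M[R]_m) :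
  [series (k`!%:R)^-1 *: A ^+ k]_k @ \oo --> expmx A.
Proof.
have [a a0 Aa] := norm_exprmx_le A.
have cA i j : cvgn (series (expmx_entry_coeff A i j)).
  apply: normed_cvg; apply: series_le_cvg (is_cvg_series_exp_coeff a) => k //=.
    exact: exp_coeff_ge0.
  exact: expmx_entry_dominated.
rewrite /expmx.
apply/cvg_ex; exists (\matrix_(i, j) limn (series (expmx_entry_coeff A i j))).
apply: cvg_entrywise => i j; rewrite mxE.
under eq_fun do rewrite series_expmxE.
exact: cA.
Qed.

Lemma expmx_entry_cvg (R : realType) (m : nat) (A : 'M[R]_m) i j :
  series (expmx_entry_coeff A i j) @ \oo --> expmx A i j.
Proof.
have := entry_cvg (i := i) (j := j) (@expmx_cvg R m A).
by under eq_fun do rewrite series_expmxE; exact.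
Qed.

(** * Shifting the exponent by a scalar matrix *)

Definition cauchy_product (R : pzSemiRingType) (a b : nat -> R) (n : nat) : R :=
  \sum_(0 <= k < n.+1) a k * b (n - k)%N.

Lemma series_cauchy_product (R : realType) (a b : nat -> R) n :
  series (cauchy_product a b) n = \sum_(0 <= k < n) a k * series b (n - k)%N.
Proof.
elim: n => [|n IH]; first by rewrite /series/= !big_geq.
rewrite seriesSr IH /cauchy_product !big_nat_recr//= subnn subSn// subnn.
rewrite /series/= !big_nat1 addrA; congr (_ + _).
rewrite -big_split/= !big_nat; apply: eq_bigr => k /andP[_ kn].
have -> : (n.+1 - k = (n - k).+1)%N by rewrite subSn// ltnW.
by rewrite [in RHS]big_nat_recr//= mulrDr.
Qed.

(** The square of indices minus the triangle: the product of two partial sums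
    misses the partial sum of the Cauchy product by the terms whose indices
    are both less than n but have a sum of at least n. *)
Lemma series_mul_sub_cauchy (R : realType) (a b : nat -> R) n :
  series a n * series b n - series (cauchy_product a b) n =
  \sum_(0 <= k < n) a k * \sum_(n - k <= l < n) b l.
Proof.
rewrite series_cauchy_product {1}/series/= mulr_suml -sumrB.
apply: eq_bigr => k _; rewrite -mulrBr; congr (_ * _).
by rewrite sub_series_geq ?leq_subr.
Qed.

(** The terms between the square and the triangle are dominated by those of the
    majorants, so it suffices to know the product formula for the latter. *)
Lemma cvg_cauchy_product (R : realType) (a b a' b' : nat -> R) (la lb : R) :
  (forall k, `|a k| <= a' k) -> (forall k, `|b k| <= b' k) ->
  series a' n * series b' n - series (cauchy_product a' b') n @[n --> \oo] --> 0 ->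
  series a @ \oo --> la -> series b @ \oo --> lb ->
  series (cauchy_product a b) @ \oo --> la * lb.
Proof.
move=> aa' bb' d0 ala blb.
have : (series a n * series b n) - (series a n * series b n
    - series (cauchy_product a b) n) @[n --> \oo] --> la * lb - 0.
  apply: cvgB; first exact: cvgM.
  apply: norm_cvg0; apply: squeeze_cvgr (cvg_cst 0) d0.
  near=> n; rewrite normr_ge0 !series_mul_sub_cauchy/=.
  rewrite (le_trans (ler_norm_sum _ _ _))//; apply: ler_sum => k _.
  rewrite normrM; apply: ler_pM => //.
  by rewrite (le_trans (ler_norm_sum _ _ _))//; apply: ler_sum.
by rewrite subr0; under eq_fun do rewrite subKr.
Unshelve. all: by end_near. Qed.

Lemma invf_fact_bin (R : numFieldType) n k : (k <= n)%N ->
  (n`!%:R)^-1 *+ 'C(n, k) = (k`!%:R)^-1 * ((n - k)`!%:R)^-1 :> R.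
Proof.
move=> kn; rewrite -(bin_fact kn) !natrM.
have f0 l : l`!%:R != 0 :> R by rewrite pnatr_eq0 -lt0n fact_gt0.
have b0 : 'C(n, k)%:R != 0 :> R by rewrite pnatr_eq0 -lt0n bin_gt0.
by rewrite -mulr_natr; field; rewrite b0 !f0.
Qed.

Lemma exp_coeffD (R : realType) (x y : R) :
  cauchy_product (exp_coeff x) (exp_coeff y) = exp_coeff (x + y).
Proof.
apply/funext => n; rewrite /cauchy_product /exp_coeff/= addrC exprDn big_mkord.
rewrite mulr_suml; apply: eq_bigr => k _.
have /(invf_fact_bin R) e : (k <= n)%N by rewrite -ltnS.
by rewrite mulrnAl -mulrnAr e; ring.
Qed.

Lemma scalar_mx_exp (R : realType) (m : nat) (x : R) k :
  (x%:M : 'M[R]_m) ^+ k = (x ^+ k)%:M.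
Proof.
elim: k => [|k IH]; first by rewrite !expr0.
by rewrite !exprS IH scalar_mxM.
Qed.

Lemma expmx_entry_coeffD (R : realType) (m : nat) (A : 'M[R]_m) (x : R) i j :
  cauchy_product (expmx_entry_coeff A i j) (exp_coeff x) =
  expmx_entry_coeff (A + x%:M) i j.
Proof.
apply/funext => n; rewrite /cauchy_product /exp_coeff /expmx_entry_coeff/=.
rewrite [A + _]addrC exprDn_comm; last exact/esym/scalar_mxC.
rewrite big_mkord summxE mulr_sumr; apply: eq_bigr => k _.
have /(invf_fact_bin R) e : (k <= n)%N by rewrite -ltnS.
rewrite scalar_mx_exp [_ * A ^+ k]mul_scalar_mx mulmxnE mxE.
by rewrite mulrnAr -mulrnAl e; ring.
Qed.

(** Entry by entry this is a Cauchy product, dominated by that of two scalar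
    exponential series, for which the product formula is expRD. *)
Lemma expmxD_scalar (R : realType) (m : nat) (A : 'M[R]_m) (x : R) :
  expmx (A + x%:M) = expR x *: expmx A.
Proof.
have [a a0 Aa] := norm_exprmx_le A.
apply/matrixP => i j; rewrite mxE mulrC.
have cR (y : R) : series (exp_coeff y) @ \oo --> expR y.
  exact: is_cvg_series_exp_coeff.
suff : series (expmx_entry_coeff (A + x%:M) i j) @ \oo -->
    expmx A i j * expR x.
  move=> h; have h' := @expmx_entry_cvg _ _ (A + x%:M) i j.
  exact: (cvg_unique _ h' h).
rewrite -expmx_entry_coeffD.
apply: (@cvg_cauchy_product _ _ _ (exp_coeff a) (exp_coeff `|x|)) => //.
- by move=> k; exact: expmx_entry_dominated.
- by move=> k; rewrite /exp_coeff/= normrM normrX [`|_^-1|]ger0_norm.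
- rewrite exp_coeffD -[X in _ --> X](subrr (expR (a + `|x|))) {1}expRD.
  exact: cvgB (cvgM (cR _) (cR _)) (cR _).
- exact: expmx_entry_cvg.
Qed.

(** * Decay of A exp(tA) *)

(** The shifted matrix is nonnegative with all row sums, or all column sums,
    equal to c.  These sums are multiplicative; the induction multiplies by one
    more factor on the left in the case of rows and on the right in the case of
    columns, and this entrywise bound no longer distinguishes the two cases. *)
Lemma intensity_shift_exp (R : realType) (m : nat) (A : 'M[R]_m) (c : R) :
  intensity A -> 0 <= c -> (forall i, - c <= A i i) ->
  forall k i j, 0 <= ((A + c%:M) ^+ k) i j <= c ^+ k.
Proof.
move=> intA c0 Ac.
have B0 i j : 0 <= (A + c%:M) i j.
  rewrite !mxE; case: eqVneq => [->|ij]; first by rewrite mulr1n -lerBlDr sub0r.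
  by rewrite mulr0n addr0; case: intA => -[+ _]; exact.
elim=> [|k IH] i j.
  by rewrite !expr0 mxE; case: eqP => _; rewrite ?lexx ler01.
case: intA => -[_ sA].
- rewrite exprS mxE; apply/andP; split.
    by apply: sumr_ge0 => l _; rewrite mulr_ge0//; case/andP: (IH l j).
  rewrite (@le_trans _ _ (\sum_l (A + c%:M) i l * c ^+ k))//.
    by apply: ler_sum => l _; rewrite ler_wpM2l//; case/andP: (IH l j).
  rewrite -mulr_suml exprS ler_wpM2r ?exprn_ge0//.
  under eq_bigr do rewrite mxE.
  rewrite big_split/= sA add0r (bigD1 i)//= big1 ?addr0 => [|l li].
    by rewrite mxE eqxx mulr1n.
  by rewrite mxE eq_sym (negbTE li) mulr0n.
- rewrite exprSr mxE; apply/andP; split.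
    by apply: sumr_ge0 => l _; rewrite mulr_ge0//; case/andP: (IH i l).
  rewrite (@le_trans _ _ (\sum_l c ^+ k * (A + c%:M) l j))//.
    by apply: ler_sum => l _; rewrite ler_wpM2r//; case/andP: (IH i l).
  rewrite -mulr_sumr exprSr ler_wpM2l ?exprn_ge0//.
  under eq_bigr do rewrite mxE.
  rewrite big_split/= sA add0r (bigD1 j)//= big1 ?addr0 => [|l li].
    by rewrite mxE eqxx mulr1n.
  by rewrite mxE (negbTE li) mulr0n.
Qed.

Lemma exp_coeffS (R : realType) (x : R) k :
  k.+1%:R * exp_coeff x k.+1 = x * exp_coeff x k.
Proof.
rewrite /exp_coeff/= factS natrM exprS -natr1.
have k0 : k`!%:R != 0 :> R by rewrite pnatr_eq0 -lt0n fact_gt0.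
by field; rewrite k0 natr1 pnatr_eq0.
Qed.

(** Truncated variance of the Poisson law of parameter x, up to the factor
    exp x.  The last summand is nonpositive once n >= x >= 0, which
    makes x exp x an upper bound. *)
Lemma series_exp_variance (R : realType) (x : R) n :
  \sum_(0 <= k < n.+1) (k%:R - x) ^+ 2 * exp_coeff x k =
  x * series (exp_coeff x) n + (x - n%:R) * x * exp_coeff x n.
Proof.
elim: n => [|n IH].
  by rewrite big_nat1 /series/= big_geq// /exp_coeff/= fact0 expr0 divr1; ring.
rewrite big_nat_recr//= IH seriesSr.
have e : n.+1%:R * exp_coeff x n.+1 = x * exp_coeff x n := exp_coeffS x n.
move: e; rewrite -natr1; set N := n%:R; set p := exp_coeff x n.
set q := exp_coeff x n.+1; set S : R := series _ _ => e.
have e' : (N + 1 - x) * ((N + 1) * q) = (N + 1 - x) * (x * p) by rewrite e.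
lra.
Qed.

(** The bound by the mean absolute deviation of the Poisson law.  Using
    2 |k - x| <= d + (k - x)^2 / d with a free d, rather than the
    Cauchy-Schwarz inequality, avoids square roots. *)
Lemma norm_mul_expmx_le (R : realType) (m : nat) (M : 'M[R]_m) (x d : R) i j :
  0 <= x -> 0 < d ->
  (forall k i j, 0 <= ((M + x%:M) ^+ k) i j <= x ^+ k) ->
  2 * `|(M *m expmx M) i j| <= d + x / d.
Proof.
move=> x0 d0 Wx; set W := M + x%:M; pose w := expmx_entry_coeff W i j.
have w0 k : 0 <= w k.
  by rewrite mulr_ge0// ?invr_ge0//; case/andP: (Wx k i j).
have wp k : w k <= exp_coeff x k.
  rewrite /w /expmx_entry_coeff /exp_coeff/= mulrC ler_wpM2r ?invr_ge0//.
  by case/andP: (Wx k i j).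
have p0 k : 0 <= exp_coeff x k := exp_coeff_ge0 k x0.
pose q n := (M *m [series (k`!%:R)^-1 *: W ^+ k]_k n) i j.
(* Sequences are taken at n.+1 because the term that remains after the index
   shift, n.+1 w_(n.+1), is then controlled by x p_n, which tends to 0. *)
have qE n : q n.+1 = \sum_(0 <= k < n.+1) (k%:R - x) * w k + n.+1%:R * w n.+1.
  have -> : q n.+1 = \sum_(0 <= k < n.+1) (k.+1%:R * w k.+1 - x * w k).
    rewrite /q /series/= mulmx_sumr summxE; apply: eq_bigr => k _.
    have -> : M = W - x%:M by rewrite addrK.
    rewrite -scalemxAr mulmxBl mul_scalar_mx [W *m W ^+ k](_ : _ = W ^+ k.+1).
      rewrite 3!mxE /w /expmx_entry_coeff [X in _ * (_ - X)]mxE.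
      have k0 : k`!%:R != 0 :> R by rewrite pnatr_eq0 -lt0n fact_gt0.
      by rewrite factS natrM -natr1; field; rewrite k0 natr1 pnatr_eq0.
    by rewrite exprS.
  elim: n => [|n IH]; first by rewrite !big_nat1; ring.
  by rewrite big_nat_recr//= IH [in RHS]big_nat_recr//=; ring.
have sumE n : series (exp_coeff x) n <= expR x.
  apply: nondecreasing_cvgn_le; last exact: is_cvg_series_exp_coeff.
  by apply/nondecreasing_series => k _ _.
have dev n : x <= n%:R ->
    2 * `|q n.+1| <= (d + x / d) * expR x + 2 * (x * exp_coeff x n).
  move=> xn.
  have amgm k : 2 * `|(k%:R - x) * w k| <=
      d * exp_coeff x k + d^-1 * ((k%:R - x) ^+ 2 * exp_coeff x k).
    rewrite normrM (ger0_norm (w0 k)) mulrA.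
    apply: (@le_trans _ _ (2 * `|k%:R - x| * exp_coeff x k)).
      by rewrite ler_wpM2l ?mulr_ge0.
    rewrite [d^-1 * _]mulrA -mulrDl ler_wpM2r//.
    rewrite -[(_ - x) ^+ 2]real_normK ?num_real// -subr_ge0.
    set u := `|_|.
    have -> : d + d^-1 * u ^+ 2 - 2 * u = d^-1 * (d - u) ^+ 2.
      by field; rewrite gt_eqF.
    by rewrite mulr_ge0 ?invr_ge0 ?(ltW d0)// sqr_ge0.
  rewrite qE (le_trans (ler_wpM2l _ (ler_normD _ _)))// mulrDr lerD//; last first.
    rewrite ler_wpM2l// -exp_coeffS ger0_norm; last by rewrite mulr_ge0.
    by rewrite ler_wpM2l.
  rewrite (le_trans (ler_wpM2l _ (ler_norm_sum _ _ _)))// mulr_sumr.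
  rewrite (le_trans (ler_sum _ (fun k _ => amgm k)))//.
  rewrite big_split/= -!mulr_sumr series_exp_variance [leRHS]mulrDl.
  apply: lerD; first by rewrite ler_wpM2l ?(ltW d0)//; exact: sumE.
  rewrite [x / d]mulrC -[leRHS]mulrA ler_wpM2l ?invr_ge0 ?(ltW d0)//.
  apply: (@le_trans _ _ (x * series (exp_coeff x) n + 0)).
    rewrite lerD2l -mulrA; apply: mulr_le0_ge0; last exact: mulr_ge0.
    by rewrite subr_le0.
  by rewrite addr0 ler_wpM2l.
have qcvg : q n.+1 @[n --> \oo] --> (M *m expmx W) i j.
  rewrite (cvg_shiftS q); apply: entry_cvg; apply: cvg_mulmxl.
  exact: expmx_cvg.
have : 2 * `|(M *m expmx W) i j| <= (d + x / d) * expR x + 2 * (x * 0).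
  apply: (@ler_cvg_to _ (\oo) _ R (fun n => 2 * `|q n.+1|)
    (fun n => (d + x / d) * expR x + 2 * (x * exp_coeff x n))).
  - by apply: cvgMl_tmp; apply: cvg_norm.
  - by apply: cvgD; [exact: cvg_cst|do 2!apply: cvgMl_tmp; exact: cvg_exp_coeff].
  - near=> n; apply: dev; near: n; exact: nbhs_infty_ger.
rewrite !mulr0 addr0 /W expmxD_scalar -scalemxAr mxE normrM.
by rewrite (ger0_norm (expR_ge0 x)) mulrCA mulrC ler_pM2r// expR_gt0.
Unshelve. all: by end_near. Qed.

Lemma intensityZ (R : realType) (m : nat) (A : 'M[R]_m) (t : R) :
  0 <= t -> intensity A -> intensity (t *: A).
Proof.
move=> t0 [] [A0 sA]; [left|right]; split=> k.
- by move=> l kl; rewrite mxE mulr_ge0// A0.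
- by under eq_bigr do rewrite mxE; rewrite -mulr_sumr sA mulr0.
- by move=> l kl; rewrite mxE mulr_ge0// A0.
- by under eq_bigr do rewrite mxE; rewrite -mulr_sumr sA mulr0.
Qed.

(** The entries of tA exp(tA) are of the order of sqrt (ct) by
    norm_mul_expmx_le, so that the factor t wins. *)
Lemma mul_expmx_cvg0 (R : realType) (m : nat) (A : 'M[R]_m) :
  intensity A -> A *m expmx (t *: A) @[t --> +oo] --> (0 : 'M[R]_m).
Proof.
move=> intA; pose c := \sum_i `|A i i|.
have c0 : 0 <= c by exact: sumr_ge0.
have Ac i : - c <= A i i.
  rewrite lerNl (le_trans (ler_norm _))// normrN /c (bigD1 i)//= lerDl.
  exact: sumr_ge0.
apply: cvg_entrywise => i j; rewrite mxE; apply/cvgrPdist_le => e e0.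
near=> t; rewrite sub0r normrN.
have t0 : 0 < t by near: t; exact: nbhs_pinfty_gt.
have tc : c / e ^+ 2 <= t by near: t; apply: nbhs_pinfty_ge; rewrite num_real.
have intB : intensity (t *: A) by exact: intensityZ (ltW t0) intA.
have tcA k : - (t * c) <= (t *: A) k k by rewrite mxE -mulrN ler_pM2l.
have tc0 : 0 <= t * c by rewrite mulr_ge0// ltW.
have te0 : 0 < t * e by rewrite mulr_gt0.
(* The choice d = t e makes both d and t c / d at most t e. *)
have := norm_mul_expmx_le i j tc0 te0 (intensity_shift_exp intB tc0 tcA).
rewrite -scalemxAl mxE normrM (gtr0_norm t0) => h.
rewrite -(ler_pM2l t0) -(ler_pM2l (ltr0n R 2)) (le_trans h)//.
rewrite [leRHS]mulr_natl [leRHS]mulr2n lerD2l -mulf_div divff ?gt_eqF// mul1r.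
by rewrite ler_pdivrMr// -mulrA -expr2 -ler_pdivrMr ?exprn_gt0.
Unshelve. all: by end_near. Qed.

(** * The final limit *)

(** Only the term of index 0 of the series survives. *)
Lemma mulmx_expmx_fixed (R : realType) (n m : nat) (K : 'M[R]_(n, m)) (A : 'M[R]_m) :
  K *m A = 0 -> K *m expmx A = K.
Proof.
move=> KA; pose u k := K *m [series (l`!%:R)^-1 *: A ^+ l]_l k.
have uK k : u k.+1 = K.
  rewrite /u /series/= mulmx_sumr big_nat_recl//= fact0 invr1 scale1r expr0.
  rewrite [K *m 1]mulmx1 big1 ?addr0// => l _.
  by rewrite -scalemxAr exprS [K *m _]mulmxA KA mul0mx scaler0.
have uE : u @ \oo --> K *m expmx A by apply: cvg_mulmxl; exact: expmx_cvg.
move: uE; rewrite -cvg_shiftS; under eq_fun do rewrite uK.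
by move=> /(cvg_unique (@norm_hausdorff _ _) (cvg_cst K)) <-.
Qed.

(** On this intersection, exp(tA) acts as the identity since it is part of the
    kernel, and tends to 0 since it is part of the image. *)
Lemma kermx_capmx_intensity (R : realType) (m : nat) (A : 'M[R]_m) :
  intensity A -> (kermx A :&: A)%MS = 0.
Proof.
move=> intA; set C := (_ :&: _)%MS.
have CA : C *m A = 0 by apply/sub_kermxP; exact: capmxSl.
have /submxP[y Cy] : (C <= A)%MS by exact: capmxSr.
have : y *m (A *m expmx (t *: A)) @[t --> +oo] --> y *m 0.
  by apply: cvg_mulmxl; exact: mul_expmx_cvg0.
rewrite mulmx0.
under eq_fun => t do rewrite mulmxA -Cy mulmx_expmx_fixed -?scalemxAr ?CA ?scaler0//.
by move=> /(cvg_unique (@norm_hausdorff _ _) (cvg_cst C)).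
Qed.

Lemma row_full_kermx_adds (F : fieldType) (m : nat) (A : 'M[F]_m) :
  (kermx A :&: A)%MS = 0 -> row_full (kermx A + A)%MS.
Proof.
move=> cap0; rewrite /row_full; apply/eqP.
have := mxrank_sum_cap (kermx A) A; rewrite cap0 mxrank0 addn0 => ->.
by rewrite mxrank_ker subnK// rank_leq_row.
Qed.

(** The two equations determine P because the kernel and the image together
    span the whole space. *)
Lemma intensity_final_limit (R : realType) (m : nat) (A : 'M[R]_m) :
  intensity A -> exists P, [/\ expmx (t *: A) @[t --> +oo] --> P,
    A *m P = 0 & kermx A *m P = kermx A].
Proof.
move=> intA.
have := row_full_kermx_adds (kermx_capmx_intensity intA).
move: (mulmx_ker A); move: (kermx A) => K KA /(submx_full 1%:M).
move=> /sub_addsmxP[[U V] /= e1].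
have KE t : K *m expmx (t *: A) = K.
  by rewrite mulmx_expmx_fixed// -scalemxAr KA scaler0.
have expE : (fun t => expmx (t *: A)) =
    (fun t => U *m K + V *m (A *m expmx (t *: A))).
  by apply/funext => t; rewrite -[LHS]mul1mx e1 mulmxDl -!mulmxA KE.
have PE : expmx (t *: A) @[t --> +oo] --> U *m K.
  rewrite expE -[X in _ --> X]addr0 -[X in _ + X](mulmx0 _ V).
  apply: cvgD; [exact: cvg_cst|apply: cvg_mulmxl; exact: mul_expmx_cvg0].
exists (U *m K); split=> //.
- apply: cvg_unique (cvg_mulmxl PE) (mul_expmx_cvg0 intA); exact: norm_hausdorff.
- have KEK : K *m expmx (t *: A) @[t --> +oo] --> K.
    by under eq_fun do rewrite KE; exact: cvg_cst.
  by apply: cvg_unique (cvg_mulmxl PE) KEK; exact: norm_hausdorff.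
Qed.

Theorem corollary3 (R : realType) (m : nat) (A : 'M[R]_m) :
  intensity A ->
  cvg (expmx (t *: A) @[t --> +oo]) /\
  let P := complexmx (lim (expmx (t *: A) @[t --> +oo])) in
  let N := left_null (complexmx A) in
  let I := left_image (complexmx A) in
  [/\ (N + I == 1%:M)%MS,
      mxdirect (N + I)
    & forall x : 'rV[R[i]]_m, x *m P = x *m proj_mx N I].
Proof.
move=> intA; have [P [PE AP KP]] := intensity_final_limit intA.
split; first by apply/cvg_ex; exists P.
rewrite /= (cvg_lim (@norm_hausdorff _ _) PE) /left_null /left_image.
have NE : kermx (complexmx A) = complexmx (kermx A) by rewrite /complexmx map_kermx.
have cap0 : (kermx (complexmx A) :&: complexmx A)%MS = 0.
  apply/eqP; rewrite -mxrank_eq0 NE -(map_capmx (real_complex R)) mxrank_map.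
  by rewrite kermx_capmx_intensity// mxrank0.
have full := row_full_kermx_adds cap0.
split.
- by rewrite submx1 submx_full.
- exact/mxdirect_addsP.
- move=> x; have /sub_addsmxP[[u v] /= ->] := submx_full x full.
  rewrite !mulmxDl -!(mulmxA u) -!(mulmxA v).
  rewrite (proj_mx_id cap0 (submx_refl _)) (proj_mx_0 cap0 (submx_refl _)).
  have -> : complexmx A *m complexmx P = 0 by rewrite -map_mxM AP map_mx0.
  by rewrite NE -map_mxM KP.
Qed.
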